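(* Let $\mathbb{K}$ be an arbitrary field and let $n$ be a non-negative integer. Let $N$ be a singular matrix of $\mathrm{M}_n(\mathbb{K})$. Let $\mathcal{S}$ be an affine subspace of $\mathrm{M}_n(\mathbb{K})$ such that $\operatorname{codim} \mathcal{S} \leq n-2$. Assume that there exists $M \in \mathcal{S}$ such that the linear operator $\operatorname{Ker} N \to \mathbb{K}^n/\operatorname{Im} N$, $X \mapsto \overline{MX}$, is non-injective, where $\overline{MX}$ denotes the class of $MX$ modulo $\operatorname{Im} N$. Then there exists $A \in \mathcal{S}$ such that every matrix of $A + \mathbb{K} N$ is invertible.
   Context: $\mathrm{M}_n(\mathbb{K})$ denotes the $\mathbb{K}$-vector space of all $n$ by $n$ matrices with entries in $\mathbb{K}$; matrices act on column vectors in $\mathbb{K}^n$, and $\operatorname{Ker} N$, $\operatorname{Im} N \subseteq \mathbb{K}^n$ are the kernel and the column space of $N$. An affine subspace is a translate of a linear subspace (its translation vector space), and its codimension in $\mathrm{M}_n(\mathbb{K})$ is $n^2$ minus the dimension of its translation vector space. $A + \mathbb{K}N := \{A + \lambda N : \lambda \in \mathbb{K}\}$. *)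

(* Defs.v *)
From HB Require Import structures.
From mathcomp Require Import all_boot all_order all_algebra.

Set Implicit Arguments.
Unset Strict Implicit.
Unset Printing Implicit Defensive.

Import GRing.Theory.
Local Open Scope ring_scope.
Local Open Scope quotient_scope.

Definition affine (K : fieldType) (E : vectType K) (a : E) (U : {vspace E}) :
  {pred E} := [pred x | x - a \in U].

Section Operators.

Variables (K : fieldType) (n : nat).

(* [kermx] and the row-space order of mxalgebra concern row vectors; here
   matrices act on column vectors, X |-> A *m X. *)
Definition colop (A : 'M[K]_n) : 'End('cV[K]_n) := linfun (mulmx A).

Definition Ker (A : 'M[K]_n) : {vspace 'cV[K]_n} := lker (colop A).

Definition Im (A : 'M[K]_n) : {vspace 'cV[K]_n} := limg (colop A).

Definition coker (A : 'M[K]_n) : Type := Quotient.quot (pred_of_vspace (Im A)).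

Definition ker_to_coker (N M : 'M[K]_n) (X : subvs_of (Ker N)) : coker N :=
  \pi_(coker N) (M *m vsval X).

(* Int-valued, so that "codim <= n - 2" is meaningful for n < 2. *)
Definition codim (U : {vspace 'M[K]_n}) : int := (n ^ 2)%N%:Z - (\dim U)%:Z.

End Operators.

(* Main.v *)
From HB Require Import structures.
Require Import Defs.
From mathcomp Require Import all_boot all_order all_algebra.
From mathcomp Require Import zify.
From Stdlib Require Import Classical.

(** Transposing, let matrices act on row vectors: there are a nonzero x and a
    matrix M of the affine space with [x *m N = 0] and [x *m M] in the row
    space of N.  The affine space is handled through the annihilator T of its
    translation space for the form [\tr (B *m D)]: it consists of the A such
    that [\tr (B *m (A - M)) = 0] for all B in T, and [\dim T <= n - 2].  The
    statement in this form, [pencil_property], is proved by induction on n.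

    Reduction.  If [x *m A = c] with c nonzero, then, since [x *m N = 0], every
    [A + lambda *: N] maps x to c, hence is invertible if and only if the map
    that it induces from [K^n / x] to [K^n / c] is.  The maps induced by the A
    of the affine space with [x *m A = c] fill an affine space of matrices of
    order [n - 1], whose annihilator has smaller dimension than T as soon as T
    contains a nonzero B whose rows are multiples of x, or some B for which
    [c *m B] is not a multiple of x.  The hypothesis on kernels survives if
    some z outside the line of x has [z *m N] on the line of c and [z *m A] in
    the row space of N ([reduce_step]).

    Finding z.  If, for a given z, no A with the prescribed [x *m A] sends z to
    the row space of N, then T contains a matrix [phi *m z + psi *m x] with phi
    nonzero ([prescribe_second_row]).  Independent vectors z give independent
    matrices, so a failure for all the available z contradicts the bound on
    [\dim T] ([count_rank_two]).  Hence the reduction applies, except when no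
    nonzero element of T has all its rows proportional to x, and all the
    matrices [N *m B] with B in T have their rows proportional to x
    ([solvable_or_constrained]).

    The exceptional case.  If the kernel of N contains a vector x' independent
    from x, then either x' opens a reduction or [N *m B = 0] for all B in T.
    In the latter case A may be replaced with [A + E *m N] for any E: an
    affine space of codimension less than n contains an invertible matrix
    ([coset_has_unit]), one is found that sends x to the row space of N, and E
    is then chosen so that the whole pencil is invertible
    ([pencil_completion]).  If the kernel of N is the line of x, the elements
    of T are of the form [phi *m z + psi *m x] with phi fixed, and one
    quotient followed by [pencil_completion] gives the result
    ([solvable_of_corank1]), unless K has two elements and n = 3.  Then x is
    instead sent outside the row space of N, which leaves a pencil of order 2
    that is made invertible with the irreducible polynomial [X^2 + X + 1]
    ([solvable_order_three]). *)

Set Implicit Arguments.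
Unset Strict Implicit.
Unset Printing Implicit Defensive.

Import GRing.Theory.
Local Open Scope ring_scope.

(** * Annihilators under the trace form *)

Definition annihilates (K : fieldType) (n : nat) (T : {vspace 'M[K]_n})
  (D : 'M[K]_n) := forall B, B \in T -> \tr (B *m D) = 0.

Lemma annihilates0 (K : fieldType) (n : nat) (T : {vspace 'M[K]_n}) :
  annihilates T 0.
Proof. by move=> B _; rewrite mulmx0 mxtrace0. Qed.

Lemma annihilates_trans (K : fieldType) (n : nat) (T : {vspace 'M[K]_n})
    (A M M' : 'M[K]_n) :
  annihilates T (M - A) -> annihilates T (M' - M) -> annihilates T (M' - A).
Proof.
move=> TM TM' B TB.
have -> : M' - A = (M' - M) + (M - A) by rewrite addrA subrK.
by rewrite mulmxDr mxtraceD TM' // TM // addr0.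
Qed.

Lemma annihilates_trace (K : fieldType) (n : nat) (T : {vspace 'M[K]_n})
    (A M : 'M[K]_n) (B : 'M[K]_n) :
  annihilates T (M - A) -> B \in T -> \tr (B *m M) = \tr (B *m A).
Proof.
by move=> TM TB; apply/eqP; rewrite -subr_eq0 -linearB /= -mulmxBr TM.
Qed.

Lemma linear_trace_repr (K : fieldType) (n : nat)
    (g : {linear 'M[K]_n -> K^o}) :
  exists D : 'M[K]_n, forall B, \tr (B *m D) = g B.
Proof.
exists (\matrix_(i, j) g (delta_mx j i)) => B.
rewrite {2}[B]matrix_sum_delta linear_sum; apply: eq_bigr => i _ /=.
rewrite mxE linear_sum; apply: eq_bigr => j _.
by rewrite mxE linearZ.
Qed.

(** A functional that vanishes on the intersection of T and Q is the sum of one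
    that vanishes on T and one that vanishes on Q.  The solvability
    results below rest on this: to find A with [A - M] orthogonal to T and satisfying
    linear conditions with annihilator Q, it suffices to check compatibility on
    the intersection of T and Q. *)
Lemma annihilates_split (K : fieldType) (n : nat) (T Q : {vspace 'M[K]_n})
    (D : 'M[K]_n) :
  annihilates (T :&: Q) D ->
  exists2 E, annihilates T E & annihilates Q (D - E).
Proof.
move=> TQD.
(* The functional that vanishes on T and agrees with D on Q, extended to the
   whole space by projecting onto Q. *)
pose g : 'M[K]_n -> K^o := fun B => \tr (addv_pi2 T Q B *m D).
have lin_g : linear g.
  by move=> a u v; rewrite /g linearP mulmxDl -scalemxAl linearP.
pose G : {linear 'M[K]_n -> K^o} := HB.pack g (GRing.isLinear.Build _ _ _ _ g lin_g).
have [E trE] := linear_trace_repr G.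
exists E => B BX; last first.
  by rewrite mulmxBr linearB /= trE /= /g addv_pi2_id // subrr.
rewrite trE /=; apply: TQD; rewrite memv_cap memv_pi2 andbT.
have /addv_pi1_pi2 defB : B \in (T + Q)%VS by rewrite (subvP (addvSl T Q)).
by rewrite -(addKr (addv_pi1 T Q B) (addv_pi2 T Q B)) defB memvD // memvN memv_pi1.
Qed.

Lemma annihilator_exists (K : fieldType) (n : nat) (V : {vspace 'M[K]_n}) :
  exists2 T : {vspace 'M[K]_n}, (\dim T <= n * n - \dim V)%N &
    forall A, annihilates T A -> A \in V.
Proof.
(* The coordinates on a complement of V are functionals whose common kernel
   is V. *)
pose k := \dim V^C; pose p (B : 'M[K]_n) := B - projv V B.
pose g i : 'M[K]_n -> K^o := fun B => coord (vbasis V^C) i (p B).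
have lin_g i : linear (g i).
  move=> a u v; rewrite /g.
  have -> : p (a *: u + v) = a *: p u + p v.
    by rewrite /p linearP scalerBr opprD addrACA.
  by rewrite linearD linearZ.
pose G i : {linear 'M[K]_n -> K^o} :=
  HB.pack (g i) (GRing.isLinear.Build _ _ _ _ (g i) (lin_g i)).
have /fin_all_exists[D trD] i := linear_trace_repr (G i).
exists <<[seq D i | i : 'I_k]>>%VS.
  by rewrite (leq_trans (dim_span _)) // size_image card_ord /k dimv_compl dimvf.
move=> A annA; have : p A = 0.
  rewrite /p (coord_vbasis (memv_projC V A)) big1 // => i _.
  rewrite -[coord _ _ _]/(G i A) -trD mxtrace_mulC annA ?scale0r //.
  by rewrite memv_span // image_f.
by move/eqP; rewrite subr_eq0 => /eqP->; apply: memv_proj.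
Qed.

(** Locked, because comparing two instances by conversion is very slow. *)
HB.lock Definition rows_in (K : fieldType) (m n : nat) (L : 'M[K]_(m, n)) :
  {vspace 'M[K]_n} := lker (linfun (mulmxr (cokermx L))).

Lemma mem_rows_in (K : fieldType) (m n : nat) (L : 'M[K]_(m, n)) (B : 'M_n) :
  (B \in rows_in L) = (B <= L)%MS.
Proof. by rewrite unlock memv_ker lfunE /= submxE. Qed.

Lemma trace_inner (K : fieldType) (n : nat) (x : 'rV[K]_n) (u : 'cV[K]_n)
    (D : 'M[K]_n) :
  \tr (u *m x *m D) = (x *m D *m u) 0 0.
Proof. by rewrite -mulmxA mxtrace_mulC trace_mx11. Qed.

Lemma dual_vector_exists (K : fieldType) (n : nat) (x z : 'rV[K]_n) :
  ~~ (z <= x)%MS -> exists2 xi : 'cV[K]_n, x *m xi = 0 & z *m xi = 1%:M.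
Proof.
rewrite submxE; set c := z *m _ => /rV0Pn[j cj].
exists ((c 0 j)^-1 *: col j (cokermx x)).
  by rewrite -scalemxAr colE mulmxA mulmx_coker mul0mx scaler0.
rewrite -scalemxAr colE mulmxA -/c -colE; apply/matrixP=> a b.
by rewrite !ord1 mxE [col _ _ _ _]mxE mulVf // mxE.
Qed.

Lemma dual_vector_exists1 (K : fieldType) (n : nat) (x : 'rV[K]_n) :
  x != 0 -> exists xi : 'cV[K]_n, x *m xi = 1%:M.
Proof.
move=> x0; have [|xi _ xxi] := @dual_vector_exists K n 0 x; last by exists xi.
by apply: contraNN x0 => /submx0null->.
Qed.

(** * Prescribing the images of one or two vectors *)

Lemma trace_nondeg (K : fieldType) (m n : nat) (A : 'M[K]_(m, n)) :
  (forall u : 'M_(n, m), \tr (u *m A) = 0) -> A = 0.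
Proof.
move=> trA; apply/matrixP=> i j; rewrite [RHS]mxE.
rewrite -(trA (delta_mx j i)) -(mul_delta_mx (0 : 'I_1)) -mulmxA mxtrace_mulC.
by rewrite trace_mx11 -colE -rowE !mxE.
Qed.

Lemma annihilates_rows_in (K : fieldType) (m n : nat) (L : 'M[K]_(m, n))
    (D : 'M_n) :
  annihilates (rows_in L) D -> L *m D = 0.
Proof.
move=> annD; apply: trace_nondeg => u.
by rewrite mulmxA annD // mem_rows_in submxMl.
Qed.

(** The conditions on T that involve only [x *m A] are those given by the
    elements of T whose rows are multiples of x, so [x *m A] ranges over
    exactly the vectors that satisfy them. *)
Lemma prescribe_row (K : fieldType) (n : nat) (T : {vspace 'M[K]_n})
    (M : 'M[K]_n) (x c : 'rV[K]_n) :
    x != 0 ->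
    (forall B, B \in T -> (B <= x)%MS -> (c - x *m M) *m B = 0) ->
  exists2 M', annihilates T (M' - M) & x *m M' = c.
Proof.
move=> /dual_vector_exists1[xi x_xi] cT.
have [|E TE] := @annihilates_split K n T (rows_in x) (xi *m (c - x *m M)).
  move=> B; rewrite memv_cap mem_rows_in => /andP[TB Bx].
  by rewrite mulmxA mxtrace_mulC mulmxA cT // mul0mx mxtrace0.
move=> /annihilates_rows_in/eqP; rewrite mulmxBr mulmxA x_xi mul1mx subr_eq0.
move=> /eqP xE; exists (M + E); first by rewrite addrC addKr.
by rewrite mulmxDr -xE addrC subrK.
Qed.

(** The conditions that [x *m A] be unchanged and that [z *m A] be congruent to u
    modulo the row space of N are annihilated by the matrices
    [phi *m z + psi *m x] with [N *m phi = 0]; the only obstruction to solving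
    them within the coset is such a matrix in T, and [phi = 0] is no
    obstruction since x keeps its image. *)
Lemma prescribe_second_row (K : fieldType) (n : nat) (T : {vspace 'M[K]_n})
    (N M : 'M[K]_n) (x z u : 'rV[K]_n) :
    ~~ (z <= x)%MS ->
  (exists M', [/\ annihilates T (M' - M), x *m M' = x *m M
                & (z *m M' - u <= N)%MS]) \/
  (exists phi psi : 'cV_n,
     [/\ phi *m z + psi *m x \in T, phi != 0 & N *m phi = 0]).
Proof.
move=> /dual_vector_exists[xi x_xi z_xi].
pose f : 'Hom('cV[K]_n, 'M[K]_n) := linfun (mulmxr z \o mulmx (cokermx N)).
pose E := xi *m (u - z *m M).
have [annE|notE] := classic (annihilates (T :&: (rows_in x + limg f)) E).
  left; have [E' TE' QE'] := annihilates_split annE.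
  have {}QE' Q : (Q <= rows_in x + limg f)%VS -> annihilates Q (E - E').
    by move=> /subvP sQ B QB; apply/QE'/sQ.
  exists (M + E'); split; first by rewrite addrC addKr.
    have /eqP := annihilates_rows_in (QE' _ (addvSl _ _)).
    rewrite mulmxBr {1}/E mulmxA x_xi mul0mx sub0r oppr_eq0 mulmxDr.
    by move=> /eqP->; rewrite addr0.
  have zE : z *m (E - E') *m cokermx N = 0.
    apply: trace_nondeg => v.
    rewrite mulmxA mxtrace_mulC !mulmxA; apply: (QE' _ (addvSr _ _)).
    by rewrite -[_ *m z]/((mulmxr z \o mulmx (cokermx N)) v) -lfunE memv_img ?memvf.
  have -> : z *m (M + E') - u = - (z *m (E - E')).
    have zE0 : z *m E = u - z *m M by rewrite mulmxA z_xi mul1mx.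
    by rewrite mulmxBr zE0 mulmxDr !opprD !opprK [LHS]addrC addrA.
  by rewrite eqmx_opp submxE zE.
right; have [B notB] := not_all_ex_not _ _ notE.
have [] := imply_to_and _ _ notB; rewrite memv_cap => /andP[TB].
case/memv_addP=> B1 B1x [_ /memv_imgP[v _ ->]] + trB.
move: B1x; rewrite mem_rows_in lfunE /= => /submxP[psi ->] defB.
exists (cokermx N *m v), psi; split; first by rewrite addrC -defB.
  apply/eqP=> v0; apply: trB.
  by rewrite defB v0 mul0mx addr0 /E mulmxA -(mulmxA psi) x_xi mulmx0 mul0mx mxtrace0.
by rewrite mulmxA mulmx_coker mul0mx.
Qed.

(** * Passing to quotients of dimension one less *)

Lemma complete_basis (K : fieldType) (n : nat) (x : 'rV[K]_(1 + n)) :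
  x != 0 -> exists2 U : 'M_(1 + n), U \in unitmx & usubmx U = x.
Proof.
move=> x0; pose a := col_ebase x; pose R := row_ebase x.
have rk1 : \rank x = 1%N by rewrite rank_rV x0.
exists (block_mx a 0 0 1%:M *m R).
  rewrite unitmx_mul row_ebase_unit andbT unitmxE det_ublock det1 mulr1 -unitmxE.
  exact: col_ebase_unit.
rewrite -mul_usub_mx block_mxEv col_mxKu.
have := mulmx_ebase x.
by rewrite rk1 (pid_mx_row K n 1) mul_mx_row mulmx1 mulmx0.
Qed.

(** If the rows of U (resp. W) form a basis with first vector x (resp. c), and
    if A maps x to a multiple of c, this is the matrix of the map induced by A
    from the quotient by x to the quotient by c.  Read with U and W exchanged,
    it also acts on the elements of annihilators. *)
Definition compress (K : fieldType) (n : nat) (U W A : 'M[K]_(1 + n)) : 'M_n :=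
  drsubmx (U *m A *m invmx W).

Fact compress_linear (K : fieldType) (n : nat) (U W : 'M[K]_(1 + n)) :
  linear (compress U W).
Proof.
move=> a A B; rewrite /compress mulmxDr -scalemxAr mulmxDl -scalemxAl.
move: (U *m A *m _) (U *m B *m _) => X Y.
by apply/matrixP=> i j; rewrite !mxE.
Qed.

HB.instance Definition _ (K : fieldType) (n : nat) (U W : 'M[K]_(1 + n)) :=
  GRing.isLinear.Build K 'M[K]_(1 + n) 'M[K]_n _ (compress U W)
    (@compress_linear K n U W).

(** The annihilator of the set of the matrices induced on the quotients.  An
    element B of T only constrains the induced matrix if it maps the first
    vector c of W to a multiple of the first vector x of U: otherwise it also
    involves the component along c of the images of the other basis vectors,
    which can be adjusted freely. *)
Definition compress_ann (K : fieldType) (n : nat) (U W : 'M[K]_(1 + n))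
    (T : {vspace 'M[K]_(1 + n)}) : {vspace 'M[K]_n} :=
  (linfun (compress W U) @: (T :&: lker (linfun
     (mulmxr (cokermx (usubmx U)) \o mulmx (usubmx W)))))%VS.

Lemma compress_annP (K : fieldType) (n : nat) (U W : 'M[K]_(1 + n))
    (T : {vspace 'M[K]_(1 + n)}) (B' : 'M_n) :
  reflect (exists B, [/\ B \in T, (usubmx W *m B <= usubmx U)%MS
                       & B' = compress W U B])
          (B' \in compress_ann U W T).
Proof.
apply: (iffP memv_imgP) => [[B] | [B [TB WB ->]]].
  rewrite memv_cap memv_ker !lfunE /= -submxE => /andP[TB WB] ->.
  by exists B.
exists B; last by rewrite lfunE.
by rewrite memv_cap TB memv_ker lfunE /= -submxE.
Qed.

Lemma usubmx_mulV (K : fieldType) (n : nat) (U : 'M[K]_(1 + n)) :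
  U \in unitmx -> usubmx U *m invmx U = row_mx 1%:M 0.
Proof.
by move=> Uu; rewrite mul_usub_mx mulmxV // scalar_mx_block block_mxEv col_mxKu.
Qed.

Lemma compress_block (K : fieldType) (n : nat) (U W A : 'M[K]_(1 + n)) k :
    W \in unitmx -> usubmx U *m A = k *: usubmx W ->
  U *m A *m invmx W =
    block_mx k%:M 0 (dlsubmx (U *m A *m invmx W)) (compress U W A).
Proof.
move=> Wu xA; rewrite -[LHS]vsubmxK block_mxEv; congr col_mx.
  rewrite -!mul_usub_mx xA -scalemxAl usubmx_mulV // scale_row_mx scaler0.
  by rewrite scalemx1.
by rewrite -[LHS]hsubmxK.
Qed.

Lemma compress_unit (K : fieldType) (n : nat) (U W A : 'M[K]_(1 + n)) :
    U \in unitmx -> W \in unitmx -> usubmx U *m A = usubmx W ->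
  (A \in unitmx) = (compress U W A \in unitmx).
Proof.
move=> Uu Wu xA; transitivity (U *m A *m invmx W \in unitmx).
  by rewrite !unitmx_mul Uu unitmx_inv Wu andbT.
rewrite (@compress_block _ _ U W A 1) ?scale1r //.
by rewrite !unitmxE det_lblock det1 mul1r.
Qed.

(** The first column below the corner, in the bases U and W, is lost in the
    quotient; it provides the freedom needed to satisfy the elements of T that
    [compress_ann] discards. *)
Lemma compress_lift (K : fieldType) (n : nat) (U W M : 'M[K]_(1 + n))
    (T : {vspace 'M[K]_(1 + n)}) (A' : 'M_n) :
    U \in unitmx -> W \in unitmx -> usubmx U *m M = usubmx W ->
    annihilates (compress_ann U W T) (A' - compress U W M) ->
  exists A, [/\ annihilates T (A - M), usubmx U *m A = usubmx W
              & compress U W A = A'].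
Proof.
move=> Uu Wu xM annA'.
(* M + E has the desired compression; it is corrected by matrices supported
   on the lost column, whose annihilator is Q. *)
pose E := invmx U *m block_mx 0 0 0 (A' - compress U W M) *m W.
pose Q := lker (linfun (mulmxr (cokermx (usubmx U)) \o mulmx (usubmx W))).
have QP B : (B \in Q) = (usubmx W *m B <= usubmx U)%MS.
  by rewrite memv_ker lfunE /= -submxE.
have trE B : \tr (B *m E) = \tr (compress W U B *m (A' - compress U W M)).
  rewrite /E !mulmxA mxtrace_mulC !mulmxA.
  rewrite -[W *m B *m invmx U]submxK mulmx_block !mulmx0 !addr0 mxtrace_block.
  by rewrite mxtrace0 !add0r.
have [|D TD QD] := @annihilates_split K _ T Q E.
  move=> B; rewrite memv_cap QP => /andP[TB QB].
  by rewrite trE annA' //; apply/compress_annP; exists B.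
pose F := U *m (E - D) *m invmx W.
have QF a c d : \tr (block_mx a 0 c d *m F) = 0.
  pose b : 'M_(1 + n) := block_mx a 0 c d; pose B := invmx W *m b *m U.
  have -> : \tr (b *m F) = \tr (B *m (E - D)).
    by rewrite /F /B !mulmxA mxtrace_mulC !mulmxA.
  apply: QD; rewrite QP /B !mulmxA usubmx_mulV // /b.
  rewrite mul_row_block !mul0mx !mul1mx !addr0.
  rewrite -[U in (_ *m U <= _)%MS]vsubmxK mul_row_col mul0mx addr0.
  exact: submxMl.
have trF a c d : \tr (a *m ulsubmx F) + \tr (c *m ursubmx F + d *m drsubmx F) = 0.
  rewrite -[RHS](QF a c d) -[in RHS](submxK F) mulmx_block mxtrace_block.
  by rewrite !mul0mx addr0.
have ulF : ulsubmx F = 0.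
  apply: trace_nondeg => a; rewrite -[RHS](trF a 0 0).
  by rewrite !mul0mx addr0 mxtrace0 addr0.
have urF : ursubmx F = 0.
  apply: trace_nondeg => c; rewrite -[RHS](trF 0 c 0).
  by rewrite !mul0mx addr0 mxtrace0 add0r.
have drF : drsubmx F = 0.
  apply: trace_nondeg => d; rewrite -[RHS](trF 0 0 d).
  by rewrite !mul0mx add0r mxtrace0 add0r.
have defE : U *m E *m invmx W = block_mx 0 0 0 (A' - compress U W M).
  by rewrite /E !mulmxA mulmxV // mul1mx mulmxK.
have xF (X : 'rV_(1 + n)) : X *m invmx W = 0 -> X = 0.
  by move=> XW; rewrite -(mulmxKV Wu X) XW mul0mx.
have xE : usubmx U *m E = 0.
  by apply: xF; rewrite !mul_usub_mx defE block_mxEv col_mxKu row_mx0.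
have xD : usubmx U *m D = 0.
  apply/eqP; rewrite -oppr_eq0 -sub0r -[X in X - _]xE -mulmxBr; apply/eqP.
  apply: xF.
  by rewrite !mul_usub_mx -/F -[F]submxK block_mxEv col_mxKu ulF urF row_mx0.
have cD : compress U W D = A' - compress U W M.
  have : compress U W (E - D) = 0 by rewrite -drF.
  rewrite linearB /= => /eqP; rewrite subr_eq0 => /eqP <-.
  by rewrite -[LHS]/(drsubmx (U *m E *m invmx W)) defE block_mxKdr.
exists (M + D); split; first by rewrite addrC addKr.
  by rewrite mulmxDr xM xD addr0.
by rewrite linearD /= cD addrC subrK.
Qed.

Lemma dim_compress_ann_le (K : fieldType) (n : nat) (U W : 'M[K]_(1 + n))
    (T : {vspace 'M[K]_(1 + n)}) :
  (\dim (compress_ann U W T) <= \dim T)%N.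
Proof.
rewrite (leq_trans _ (dimvS (capvSl T (lker (linfun
     (mulmxr (cokermx (usubmx U)) \o mulmx (usubmx W))))))) //.
by rewrite /compress_ann -[leqRHS](limg_ker_dim (linfun (compress W U))) leq_addl.
Qed.

(** An element with rows proportional to the first vector of U is killed by the
    quotient map, and one that does not send the first vector of W to the line
    of the first vector of U is discarded. *)
Lemma dim_compress_ann_lt (K : fieldType) (n : nat) (U W : 'M[K]_(1 + n))
    (T : {vspace 'M[K]_(1 + n)}) (B : 'M_(1 + n)) :
    U \in unitmx -> B \in T -> B != 0 ->
    (B <= usubmx U)%MS || ~~ (usubmx W *m B <= usubmx U)%MS ->
  (\dim (compress_ann U W T) < \dim T)%N.
Proof.
move=> Uu TB B0 drop; pose Q := lker (linfun
     (mulmxr (cokermx (usubmx U)) \o mulmx (usubmx W))).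
have QP C : (C \in Q) = (usubmx W *m C <= usubmx U)%MS.
  by rewrite memv_ker lfunE /= -submxE.
have dimT := limg_ker_dim (linfun (compress W U)) (T :&: Q).
case: (boolP (B \in Q)) => QB; last first.
  rewrite (@leq_ltn_trans (\dim (T :&: Q))) //; first by rewrite -dimT leq_addl.
  rewrite ltn_neqAle dimvS ?capvSl // andbT; apply: contraNneq QB => eqT.
  have /eqP eqTQ : (T :&: Q)%VS == T by rewrite eqEdim capvSl eqT leqnn.
  by move: TB; rewrite -eqTQ memv_cap => /andP[].
move: drop; rewrite -QP QB orbF => /submxP[u defB].
rewrite (leq_trans _ (dimvS (capvSl T Q))) // -dimT -[leqLHS]add1n leq_add2r.
rewrite lt0n dimv_eq0; apply: contraNneq B0 => capQ0.
rewrite -memv0 -capQ0 !memv_cap TB QB memv_ker lfunE /= /compress.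
rewrite defB !mulmxA -mulmxA usubmx_mulV // -[W *m u]vsubmxK mul_col_mx.
by rewrite /drsubmx col_mxKd mul_mx_row row_mxKr mulmx0.
Qed.

(** The kernel hypothesis of the induction passes to the quotients: the image of
    z is a nonzero kernel vector of the matrix induced by N. *)
Lemma compress_kernel (K : fieldType) (n : nat) (U W N M : 'M[K]_(1 + n))
    (z : 'rV_(1 + n)) :
    U \in unitmx -> W \in unitmx -> usubmx U *m N = 0 ->
    usubmx U *m M = usubmx W ->
    ~~ (z <= usubmx U)%MS -> (z *m N <= usubmx W)%MS ->
  exists z' : 'rV_n, [/\ z' != 0, z' *m compress U W N = 0
    & (z *m M <= N + usubmx W)%MS ->
      (z' *m compress U W M <= compress U W N)%MS].
Proof.
move=> Uu Wu xN xM zU zN.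
have [v defz] : exists v, z = v *m U by exists (z *m invmx U); rewrite mulmxKV.
have vE : v = row_mx (lsubmx v) (rsubmx v) by rewrite hsubmxK.
have WV : usubmx W *m invmx W = row_mx 1%:M 0 := usubmx_mulV Wu.
have rW (k : 'rV_(1 + n)) : (k <= usubmx W)%MS -> rsubmx (k *m invmx W) = 0.
  by move=> /submxP[u ->]; rewrite -mulmxA WV mul_mx_row mulmx0 row_mxKr.
have xN' : usubmx U *m N = 0 *: usubmx W by rewrite scale0r.
have xM' : usubmx U *m M = 1 *: usubmx W by rewrite scale1r.
have zNV : rsubmx (z *m N *m invmx W) = rsubmx v *m compress U W N.
  rewrite defz -!mulmxA (mulmxA U) (compress_block Wu xN').
  by rewrite [X in X *m block_mx _ _ _ _]vE mul_row_block row_mxKr mulmx0 add0r.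
have zMV : rsubmx (z *m M *m invmx W) = rsubmx v *m compress U W M.
  rewrite defz -!mulmxA (mulmxA U) (compress_block Wu xM').
  by rewrite [X in X *m block_mx _ _ _ _]vE mul_row_block row_mxKr mulmx0 add0r.
exists (rsubmx v); split.
- apply: contraNneq zU => v0; rewrite defz vE v0 -[X in (_ *m X <= _)%MS]vsubmxK.
  by rewrite mul_row_col mul0mx addr0 submxMl.
- by rewrite -zNV; apply: rW.
move=> /sub_addsmxP[[a b] /= defzM].
have aN : U *m N *m invmx W =
    block_mx 0 0 (dlsubmx (U *m N *m invmx W)) (compress U W N).
  rewrite {1}(compress_block Wu xN'); congr block_mx.
  by apply/matrixP=> i j; rewrite !mxE mul0rn.
rewrite -zMV defzM mulmxDl linearD /= (rW (b *m _)) ?submxMl // addr0.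
rewrite -(mulmxKV Uu a) -!mulmxA (mulmxA U) aN mulmxA.
set a' := (X in X *m block_mx _ _ _ _).
rewrite -[a']hsubmxK mul_row_block row_mxKr mulmx0 add0r.
exact: submxMl.
Qed.

Lemma compress_common_kernel (K : fieldType) (n : nat)
    (U W N M : 'M[K]_(1 + n)) :
    U \in unitmx -> W \in unitmx -> usubmx U *m N = 0 ->
    usubmx U *m M = usubmx W ->
    (forall theta : 'cV_(1 + n), N *m theta = 0 -> M *m theta = 0 -> theta = 0) ->
  forall theta : 'cV_n,
    compress U W N *m theta = 0 -> compress U W M *m theta = 0 -> theta = 0.
Proof.
move=> Uu Wu xN xM inj theta Nt Mt.
have bl A k : usubmx U *m A = k *: usubmx W -> compress U W A *m theta = 0 ->
    A *m (invmx W *m col_mx 0 theta) = 0.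
  move=> xA At; rewrite -[A](mulKmx Uu) -mulmxA.
  rewrite (mulmxA (U *m A)) (compress_block Wu xA) mul_block_col At.
  by rewrite !mulmx0 mul0mx !addr0 col_mx0 mulmx0.
have /(congr1 (mulmx W)) : invmx W *m col_mx 0 theta = 0.
  by apply: inj; [apply: (@bl _ 0) | apply: (@bl _ 1)]; rewrite ?scale0r ?scale1r.
by rewrite mulKVmx // mulmx0 -col_mx0 => /eq_col_mx[].
Qed.

(** The product of the matrices of N and B in the bases U and W is the matrix of
    [N *m B], whose rows vanish modulo x. *)
Lemma compress_ann_mul0 (K : fieldType) (n : nat) (U W N : 'M[K]_(1 + n))
    (T : {vspace 'M[K]_(1 + n)}) :
    U \in unitmx -> W \in unitmx -> usubmx U *m N = 0 ->
    (forall B, B \in T -> (N *m B <= usubmx U)%MS) ->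
  forall B', B' \in compress_ann U W T -> compress U W N *m B' = 0.
Proof.
move=> Uu Wu xN NT B' /compress_annP[B [TB /submxP[k defk] ->]].
have xN0 : usubmx U *m N = 0 *: usubmx W by rewrite scale0r.
have kB : usubmx W *m B = k 0 0 *: usubmx U.
  by rewrite defk [k]mx11_scalar mul_scalar_mx mxE eqxx mulr1n.
have /submxP[v NB] := NT B TB.
have : drsubmx (U *m N *m invmx W *m (W *m B *m invmx U)) = 0.
  have -> : U *m N *m invmx W *m (W *m B *m invmx U) = U *m v *m row_mx 1%:M 0.
    by rewrite -(usubmx_mulV Uu) -!mulmxA (mulKmx Wu) (mulmxA N) NB !mulmxA.
  rewrite -[U *m v]vsubmxK mul_col_mx /drsubmx col_mxKd.
  by rewrite mul_mx_row row_mxKr mulmx0.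
rewrite (compress_block Wu xN0) (compress_block Uu kB) mulmx_block block_mxKdr.
by rewrite mulmx0 add0r.
Qed.

Lemma compress_nonsingular (K : fieldType) (n : nat) (U W N : 'M[K]_(1 + n)) :
    U \in unitmx -> W \in unitmx -> usubmx U *m N = 0 ->
    (forall z : 'rV_(1 + n), (z *m N <= usubmx W)%MS -> (z <= usubmx U)%MS) ->
  compress U W N \in unitmx.
Proof.
move=> Uu Wu xN inj; rewrite -row_free_unit -kermx_eq0; apply/rowV0P=> z.
move=> /sub_kermxP zN0.
have xN0 : usubmx U *m N = 0 *: usubmx W by rewrite scale0r.
have /submxP[k] : (row_mx 0 z *m U <= usubmx U)%MS.
  apply: inj.
  have -> : row_mx 0 z *m U *m N = row_mx 0 z *m (U *m N *m invmx W) *m W.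
    by rewrite !mulmxA mulmxKV.
  rewrite (compress_block Wu xN0) mul_row_block zN0 !mul0mx !add0r.
  rewrite -[X in _ *m X]vsubmxK mul_row_col mul0mx addr0.
  exact: submxMl.
move=> /(congr1 (mulmxr (invmx U))) /=; rewrite mulmxK // -mulmxA usubmx_mulV //.
by rewrite mul_mx_row mulmx0 => /eq_row_mx[].
Qed.

(** * Invertible pencils, and invertible matrices in cosets *)

(** Without constraints, A is chosen to map a kernel vector x of N to a nonzero
    vector [c = z *m N] of the row space: then z becomes a kernel vector in the
    quotient, and induction on n applies. *)
Lemma singular_pencil (K : fieldType) (n : nat) (N : 'M[K]_n) (x : 'rV[K]_n) :
  x != 0 -> x *m N = 0 ->
  exists A, forall lambda : K, A + lambda *: N \in unitmx.
Proof.
elim: n N x => [|n IHn] N x x0 xN.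
  by move: x0; rewrite [x]thinmx0 eqxx.
have [->|N0] := eqVneq N 0.
  by exists 1%:M => lambda; rewrite scaler0 addr0 unitmx1.
have /rowV0Pn[c /submxP[z defc] c0] := N0.
have [U Uu Ux] := @complete_basis K n x x0.
have [W Wu Wc] := @complete_basis K n c c0.
have [M _ xM] : exists2 M, annihilates 0 (M - 0) & x *m M = c.
  by apply: prescribe_row => // B; rewrite memv0 => /eqP-> _; rewrite mulmx0.
move: xN xM; rewrite -Ux -Wc => xN xM.
have zU : ~~ (z <= usubmx U)%MS.
  by apply: contra c0 => /submxP[k defz]; rewrite defc defz -mulmxA xN mulmx0.
have [|z' [z'0 z'N _]] := compress_kernel Uu Wu xN xM zU.
  by rewrite -defc Wc.
have [A' A'u] := IHn _ _ z'0 z'N.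
have [|A [_ xA cA]] := @compress_lift _ _ U W M 0%VS A' Uu Wu xM.
  move=> B' /compress_annP[B [+ _ ->]]; rewrite memv0 => /eqP->.
  by rewrite linear0 mul0mx mxtrace0.
exists A => lambda; rewrite (compress_unit Uu Wu).
  by rewrite linearD linearZ /= cA.
by rewrite mulmxDr -scalemxAr xN scaler0 addr0.
Qed.

(** The columns of Psi represent a basis of the elements of T with rows
    proportional to x, so that the rank of the constraints on the image of x is
    at most the number of these columns. *)
Lemma row_constraints (K : fieldType) (n : nat) (T : {vspace 'M[K]_n})
    (x : 'rV[K]_n) :
    x != 0 ->
  exists Psi : 'M[K]_(n, \dim (T :&: rows_in x)), forall c : 'rV_n,
    c *m Psi = 0 -> forall B, B \in T -> (B <= x)%MS -> c *m B = 0.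
Proof.
move=> /dual_vector_exists1[xi x_xi]; set Tx := (T :&: _)%VS.
exists (\matrix_(i, j) ((vbasis Tx)`_j *m xi) i 0) => c cPsi B TB Bx.
have /coord_vbasis-> : B \in Tx by rewrite memv_cap TB mem_rows_in.
rewrite mulmx_sumr big1 // => j _; rewrite -scalemxAr.
have Tj : (vbasis Tx)`_j \in Tx by rewrite vbasis_mem // mem_nth ?size_tuple.
have /submxP[u defj] : ((vbasis Tx)`_j <= x)%MS.
  by move: Tj; rewrite memv_cap mem_rows_in => /andP[].
suff cu : c *m u = 0 by rewrite defj mulmxA cu mul0mx scaler0.
apply/matrixP=> a b; rewrite !ord1 [RHS]mxE.
have /rowP/(_ j) := cPsi; rewrite [RHS]mxE => <-.
rewrite mxE [RHS]mxE; apply: eq_bigr => k _; congr (_ * _).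
by rewrite [RHS]mxE defj -mulmxA x_xi mulmx1.
Qed.

Lemma nonzero_or_zero (K : fieldType) (vT : vectType K) (V : {vspace vT}) :
  V = 0%VS \/ exists2 v, v \in V & v != 0.
Proof.
have [->|V0] := eqVneq V 0%VS; first by left.
by right; exists (vpick V); rewrite ?memv_pick ?vpick0.
Qed.

(** Dieudonne's bound for affine spaces of singular matrices, over any field:
    fix the image c of some x and pass to the quotients.  The codimension drops
    if T contains a nonzero matrix with rows proportional to x; otherwise c is
    unrestricted and can be taken so that some element of T does not send it to
    the line of x. *)
Lemma coset_has_unit (K : fieldType) (n : nat) (T : {vspace 'M[K]_n})
    (M : 'M[K]_n) :
  (\dim T < n)%N -> exists2 A, annihilates T (A - M) & A \in unitmx.
Proof.
elim: n T M => // n IHn T M dimT.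
have [T0|[B TB B0]] := nonzero_or_zero T.
  exists 1%:M; last exact: unitmx1.
  by move=> B; rewrite T0 memv0 => /eqP->; rewrite mul0mx mxtrace0.
pose x : 'rV[K]_(1 + n) := delta_mx 0 0.
have x0 : x != 0 by apply/rV0Pn; exists 0; rewrite mxE !eqxx oner_eq0.
suff [M1 [TM1 xM1 [B1 [TB1 B10 drop]]]] : exists M1, [/\ annihilates T (M1 - M),
    x *m M1 != 0 & exists B1, [/\ B1 \in T, B1 != 0 &
      (B1 <= x)%MS || ~~ (x *m M1 *m B1 <= x)%MS]].
  have [U Uu Ux] := @complete_basis K n x x0.
  have [W Wu Wc] := @complete_basis K n _ xM1.
  move: drop; rewrite -Wc -Ux => /(dim_compress_ann_lt Uu TB1 B10) ltT.
  have [A' TA' A'u] := IHn _ (compress U W M1) (leq_trans ltT dimT).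
  have xM : usubmx U *m M1 = usubmx W by rewrite Ux Wc.
  have [A [TA xA cA]] := compress_lift Uu Wu xM TA'.
  by exists A; rewrite ?(compress_unit Uu Wu) ?cA //; apply: annihilates_trans TA.
have [Tx0|[B1]] := nonzero_or_zero (T :&: rows_in x).
- have Tx B' : B' \in T -> (B' <= x)%MS -> B' = 0.
    by move=> TB' xB'; apply/eqP; rewrite -memv0 -Tx0 memv_cap TB' mem_rows_in.
  have /row_subPn[i Bi] : ~~ (B <= x)%MS by apply: contra B0 => /(Tx _ TB)->.
  have [M1 TM1 xM1] : exists2 M1, annihilates T (M1 - M) & x *m M1 = delta_mx 0 i.
    by apply: prescribe_row => // B' TB' /(Tx _ TB')->; rewrite mulmx0.
  exists M1; split => //; rewrite xM1.
    by apply/rV0Pn; exists i; rewrite mxE !eqxx oner_eq0.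
  by exists B; rewrite -rowE Bi orbT.
rewrite memv_cap mem_rows_in => /andP[TB1 xB1] B10.
have [M1 TM1 xM1] : exists2 M1, annihilates T (M1 - M) & x *m M1 != 0.
  have [xM0|] := eqVneq (x *m M) 0;
    last by exists M; rewrite // subrr; apply: annihilates0.
  have [Psi PsiP] := row_constraints T x0.
  have /rowV0Pn[c /sub_kermxP cPsi c0] : kermx Psi != 0.
    rewrite -mxrank_eq0 mxrank_ker -lt0n subn_gt0 (leq_ltn_trans (rank_leq_col _)) //.
    by rewrite (leq_ltn_trans _ dimT) // dimvS ?capvSl.
  have [|M1 TM1 xM1] := @prescribe_row _ _ T M x c x0; last by exists M1; rewrite ?xM1.
  by rewrite xM0 subr0; apply: PsiP.
by exists M1; split => //; exists B1; rewrite xB1.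
Qed.

(** * Completing a matrix known modulo the row space of N *)

Lemma unitmx_row_kernel (K : fieldType) (n : nat) (A : 'M[K]_n) :
  (forall v : 'rV_n, v *m A = 0 -> v = 0) -> A \in unitmx.
Proof.
move=> inj; rewrite -row_free_unit -kermx_eq0; apply/rowV0P=> v.
by move=> /sub_kermxP/inj.
Qed.

(** The vectors v with [v *m M] in the row space of N form, by the condition on
    column kernels, a space W of dimension [\rank N], and only there can
    [M + E *m N + lambda *: N] fail to be injective.  On W this pencil takes
    its values in the row space of N, and E makes its constant term an
    arbitrary square matrix of order [\rank N].  As x lies in W and in the
    kernel of N, the coefficient of lambda is singular, and [singular_pencil]
    provides the constant term. *)
Lemma pencil_completion (K : fieldType) (n : nat) (N M : 'M[K]_n)
    (x : 'rV[K]_n) :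
    x != 0 -> x *m N = 0 -> (x *m M <= N)%MS ->
    (forall theta : 'cV_n, N *m theta = 0 -> M *m theta = 0 -> theta = 0) ->
  exists E, forall lambda : K, M + E *m N + lambda *: N \in unitmx.
Proof.
move=> x0 xN xM inj; pose G := M *m cokermx N.
have rkG : \rank (kermx G) = \rank N.
  have cap0 : ((cokermx N)^T :&: kermx M^T)%MS = 0.
    apply/eqP/rowV0P=> v; rewrite sub_capmx => /andP[/submxP[k defv]].
    move=> /sub_kermxP vM; apply: trmx_inj; rewrite trmx0; apply: inj.
      by rewrite defv trmx_mul trmxK mulmxA mulmx_coker mul0mx.
    by apply: trmx_inj; rewrite trmx_mul trmxK vM trmx0.
  have := mxrank_mul_ker (cokermx N)^T M^T.
  rewrite cap0 mxrank0 addn0 -trmx_mul !mxrank_tr mxrank_ker -/G => ->.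
  by rewrite mxrank_coker subKn // rank_leq_row.
have [W Wfree WG] : exists2 W : 'M_(\rank N, n), row_free W & (W :=: kermx G)%MS.
  rewrite -rkG; exists (row_base (kermx G)); first exact: row_base_free.
  exact: eq_row_base.
have /submxP[Y WM] : (W *m M <= N)%MS.
  by rewrite submxE -mulmxA; apply/eqP/sub_kermxP; rewrite WG.
have /submxP[w defx] : (x <= W)%MS.
  by rewrite WG; apply/sub_kermxP; rewrite mulmxA; apply/eqP; rewrite -submxE.
have [L [R [NE Lfull Rfree]]] : exists (L : 'M_(n, \rank N)) (R : 'M_(\rank N, n)),
    [/\ N = L *m R, row_full L & row_free R].
  by exists (col_base N), (row_base N); rewrite mulmx_base col_base_full row_base_free.
have Rinj m (A : 'M_(m, \rank N)) : A *m R = 0 -> A = 0.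
  by move=> AR; apply: (row_free_inj Rfree); rewrite mul0mx.
have w0 : w != 0 by apply: contraNneq x0 => w0; rewrite defx w0 mul0mx.
have wWL : w *m (W *m L) = 0.
  apply: Rinj; rewrite -!mulmxA. by rewrite -NE mulmxA -defx.
have [A Au] := singular_pencil w0 wWL.
have /row_freeP[W' WW'] := Wfree.
have /row_fullP[L' L'L] := Lfull.
(* This E satisfies W *m E *m L = A - Y *m L, so that the restriction to W
   of the pencil is (A + lambda *: (W *m L)) *m R. *)
exists (W' *m (A - Y *m L) *m L') => lambda; apply: unitmx_row_kernel => v v0.
have /submxP[u defv] : (v <= W)%MS.
  rewrite WG; apply/sub_kermxP.
  have := congr1 (mulmxr (cokermx N)) v0; rewrite /= mul0mx -mulmxA.
  by rewrite !mulmxDl -scalemxAl -!mulmxA mulmx_coker !mulmx0 scaler0 !addr0.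
suff u0 : u *m (A + lambda *: (W *m L)) = 0.
  by rewrite defv -(mulmxK (Au lambda) u) u0 !mul0mx.
apply: Rinj; rewrite -[RHS]v0 defv -mulmxA -[RHS]mulmxA; congr (_ *m _).
rewrite mulmxDl -scalemxAl -(mulmxA W L) -NE mulmxDr [W *m (M + _)]mulmxDr.
rewrite -scalemxAr WM; congr (_ + _).
have YN : Y *m N = Y *m L *m R by rewrite -mulmxA -NE.
have EN : W *m (W' *m (A - Y *m L) *m L' *m N) = (A - Y *m L) *m R.
  rewrite [X in _ *m (_ *m X)]NE 3!(mulmxA W) WW' mul1mx.
  by rewrite -mulmxA (mulmxA L') L'L mul1mx.
by rewrite EN YN mulmxBl addrC subrK.
Qed.

Definition pencil_solvable (K : fieldType) (n : nat) (N M : 'M[K]_n)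
    (T : {vspace 'M[K]_n}) : Prop :=
  exists2 A, annihilates T (A - M) & forall lambda : K, A + lambda *: N \in unitmx.

Lemma pencil_solvable_base (K : fieldType) (n : nat) (N M M1 : 'M[K]_n)
    (T : {vspace 'M[K]_n}) :
  annihilates T (M1 - M) -> pencil_solvable N M1 T -> pencil_solvable N M T.
Proof. by move=> TM1 [A TA Au]; exists A => //; apply: annihilates_trans TA. Qed.

(** Every [E *m N] is orthogonal to T, so x can first be sent to a nonzero c in
    the row space of N.  Once x is sent to c, an invertible matrix is found in
    the quotients by [coset_has_unit], for which the bound on [\dim T] leaves
    exactly enough room, and [pencil_completion] concludes. *)
Lemma solvable_of_mul0 (K : fieldType) (n : nat) (N M : 'M[K]_n)
    (T : {vspace 'M[K]_n}) (x : 'rV[K]_n) :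
    N != 0 -> x != 0 -> x *m N = 0 -> (x *m M <= N)%MS -> (\dim T + 2 <= n)%N ->
    (forall B, B \in T -> N *m B = 0) ->
  pencil_solvable N M T.
Proof.
case: n N M T x => [|n] N M T x; first by rewrite [x]thinmx0 eqxx.
move=> /rowV0Pn[c /submxP[y defc] c0] x0 xN /submxP[y0 xM] dimT NT.
have addE E : annihilates T (E *m N).
  by move=> B TB; rewrite mxtrace_mulC -mulmxA NT // mulmx0 mxtrace0.
have [xi x_xi] := dual_vector_exists1 x0.
pose M1 := M + xi *m (y - y0) *m N.
have xM1 : x *m M1 = c.
  rewrite /M1 [x *m (M + _)]mulmxDr !mulmxA x_xi mul1mx mulmxBl xM -defc.
  by rewrite addrC subrK.
have [U Uu Ux] := @complete_basis K n x x0.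
have [W Wu Wc] := @complete_basis K n c c0.
have [|A' TA' A'u] := @coset_has_unit K n (compress_ann U W T) (compress U W M1).
  by rewrite (leq_ltn_trans (dim_compress_ann_le _ _ _)) //; move: dimT; rewrite addn2.
rewrite -Ux -Wc in xM1.
have [A1 [TA1 xA1 cA1]] := compress_lift Uu Wu xM1 TA'.
have A1u : A1 \in unitmx by rewrite (compress_unit Uu Wu xA1) cA1.
have [|theta _ A10|E EP] := @pencil_completion K _ N A1 x x0 xN.
- by rewrite -Ux xA1 Wc defc submxMl.
- by rewrite -[theta](mulKmx A1u) A10 mulmx0.
exists (A1 + E *m N) => //.
apply: (@annihilates_trans _ _ _ _ A1); last by rewrite addrC addKr.
by apply: (annihilates_trans _ TA1); rewrite addrC addKr.
Qed.

(** * The inductive step and the dimension count *)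

Definition pencil_property (K : fieldType) (n : nat) : Prop :=
  forall (N M : 'M[K]_n) (T : {vspace 'M[K]_n}) (x : 'rV[K]_n),
    x != 0 -> x *m N = 0 -> (x *m M <= N)%MS -> (\dim T + 2 <= n)%N ->
  pencil_solvable N M T.

(** The two alternatives for B are those that make the annihilator smaller in the
    quotients. *)
Lemma reduce_step (K : fieldType) (n : nat) (N M M1 : 'M[K]_n.+1)
    (T : {vspace 'M[K]_n.+1}) (x z : 'rV[K]_n.+1) (B : 'M[K]_n.+1) :
    pencil_property K n -> (\dim T + 2 <= n.+1)%N ->
    annihilates T (M1 - M) -> x *m N = 0 -> x *m M1 != 0 ->
    ~~ (z <= x)%MS -> (z *m N <= x *m M1)%MS -> (z *m M1 <= N)%MS ->
    B \in T -> B != 0 -> (B <= x)%MS || ~~ (x *m M1 *m B <= x)%MS ->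
  pencil_solvable N M T.
Proof.
move=> IHn dimT TM1 xN xM1 zx zN zM TB B0 drop.
have x0 : x != 0 by apply: contraNneq xM1 => ->; rewrite mul0mx.
have [U Uu Ux] := @complete_basis K n x x0.
have [W Wu Wc] := @complete_basis K n _ xM1.
have ltT : (\dim (compress_ann U W T) < \dim T)%N.
  by apply: (dim_compress_ann_lt Uu TB B0); rewrite Ux Wc.
rewrite -Ux in xN; have xM : usubmx U *m M1 = usubmx W by rewrite Ux Wc.
have [||z' [z'0 z'N z'M]] := @compress_kernel _ _ _ _ _ _ z Uu Wu xN xM.
- by rewrite Ux.
- by rewrite Wc.
have [||A' TA' A'u] := IHn _ (compress U W M1) (compress_ann U W T) _ z'0 z'N.
- by rewrite z'M // (submx_trans zM) // addsmxSl.
- rewrite addn2; apply: (@leq_trans (\dim T).+1); first exact: ltT.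
  by move: dimT; rewrite addn2.
have [A [TA xA cA]] := compress_lift Uu Wu xM TA'.
exists A => [|lambda]; first exact: annihilates_trans TA.
rewrite (compress_unit Uu Wu); last by rewrite mulmxDr -scalemxAr xN scaler0 addr0.
by rewrite linearD linearZ /= cA.
Qed.

Lemma outer_submx (K : fieldType) (m n p : nat) (phi : 'cV[K]_m)
    (z : 'rV[K]_n) (L : 'M[K]_(p, n)) :
  phi != 0 -> (phi *m z <= L)%MS -> (z <= L)%MS.
Proof.
rewrite -trmx_eq0 => /dual_vector_exists1[xi phi_xi]; apply: submx_trans.
have {1}-> : z = xi^T *m (phi *m z); last exact: submxMl.
by rewrite mulmxA -[phi]trmxK -trmx_mul phi_xi trmx1 mul1mx.
Qed.

(** A flag that starts at the line of x is enlarged by one suitable z at a time.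
    The corresponding [phi *m z + psi *m x] has its rows in the new subspace but
    not in the previous one, so the elements of T with rows in the current
    member of the flag gain at least one dimension at each step.  G stands for
    success, which interrupts the construction. *)
Lemma count_rank_two (K : fieldType) (n m : nat) (T : {vspace 'M[K]_n})
    (x : 'rV[K]_n) (G : Prop) :
    x != 0 ->
    (forall L : 'M_n, (x <= L)%MS -> (\rank L <= m)%N ->
       G \/ exists (z : 'rV_n) (phi psi : 'cV_n),
              [/\ ~~ (z <= L)%MS, phi *m z + psi *m x \in T & phi != 0]) ->
  G \/ (\dim (T :&: rows_in x) + m <= \dim T)%N.
Proof.
move=> x0 step.
suff [|[L [_ _ dimL]]] : G \/ exists L : 'M_n, [/\ (x <= L)%MS, (\rank L <= m.+1)%N
    & (\dim (T :&: rows_in x) + m <= \dim (T :&: rows_in L))%N].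
- by left.
- by right; apply: leq_trans dimL _; rewrite dimvS ?capvSl.
elim: m step => [|m IHm] step.
  right; exists <<x>>%MS; rewrite addn0; split; first by rewrite genmxE.
    by rewrite genmxE rank_rV x0.
  by rewrite dimvS // capvS //; apply/subvP=> B; rewrite !mem_rows_in genmxE.
case: IHm => [L xL rL|gG|[L [xL rL dimL]]]; first by apply: step; rewrite ?(leq_trans rL).
  by left.
have [gG|[z [phi [psi [zL TB phi0]]]]] := step L xL rL; first by left.
right; exists (L + z)%MS; split.
- by rewrite (submx_trans xL) // addsmxSl.
- by rewrite (leq_trans (mxrank_adds_leqif L z)) // -[m.+2]addn1 leq_add // rank_leq_row.
have sL : (T :&: rows_in L <= T :&: rows_in (L + z)%MS)%VS.
  apply: capvS => //; apply/subvP=> B; rewrite !mem_rows_in => /submx_trans; apply.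
  exact: addsmxSl.
rewrite addnS (leq_ltn_trans dimL) // ltn_neqAle dimvS // andbT.
apply: contra zL => /eqP eqdim.
have /eqP eqTL : (T :&: rows_in L == T :&: rows_in (L + z)%MS)%VS.
  by rewrite eqEdim sL eqdim leqnn.
have : phi *m z + psi *m x \in (T :&: rows_in L)%VS.
  rewrite eqTL memv_cap TB mem_rows_in addmx_sub // mulmx_sub ?addsmxSr //.
  by rewrite (submx_trans xL) // addsmxSl.
rewrite memv_cap mem_rows_in => /andP[_ sBL]; apply: (outer_submx phi0).
by rewrite -(addrK (psi *m x) (phi *m z)) addmx_sub // eqmx_opp mulmx_sub.
Qed.

(** Over the field with two elements an affine space can be covered by two proper
    affine subspaces, but not by L and Av here: if the affine space meets Av,
    it is the linear space U, which is not the union of two proper linear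
    subspaces. *)
Lemma affine_avoid (K : fieldType) (n : nat) (U Av L : 'M[K]_n)
    (y0 z1 : 'rV[K]_n) :
    (Av <= U)%MS -> (z1 - y0 <= U)%MS -> ~~ (z1 <= Av)%MS -> ~~ (U <= L)%MS ->
  exists z, [/\ (z - y0 <= U)%MS, ~~ (z <= L)%MS & ~~ (z <= Av)%MS].
Proof.
move=> AvU z1U z1Av /row_subPn[i]; set u := row i U => uL.
have uU : (u <= U)%MS by apply: row_sub.
have [z1L|z1L] := boolP (z1 <= L)%MS; last by exists z1.
have z1uU : ((z1 + u - y0)%R <= U)%MS by rewrite addrAC addmx_sub.
have [z1uAv|z1uAv] := boolP ((z1 + u)%R <= Av)%MS; last first.
  exists (z1 + u); split; [exact: z1uU | | exact: z1uAv].
  apply: contra uL => z1uL.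
  by rewrite -(addrK z1 u) (addrC u) addmx_sub ?eqmx_opp.
have z1E : z1 = z1 + u - u by rewrite addrK.
exists u; split=> //.
  have -> : u - y0 = (z1 + u - y0) - z1 by rewrite [RHS]addrAC (addrC z1) addrK.
  rewrite addmx_sub // eqmx_opp z1E addmx_sub ?eqmx_opp //.
  exact: submx_trans AvU.
by apply: contra z1Av => uAv; rewrite z1E addmx_sub ?eqmx_opp.
Qed.

(** * Finding a vector along which to reduce *)

Lemma forall_submx_or (K : fieldType) (n : nat) (T : {vspace 'M[K]_n})
    (N : 'M[K]_n) (x : 'rV[K]_n) :
  (forall B, B \in T -> (N *m B <= x)%MS) \/
  (exists2 B, B \in T & ~~ (N *m B <= x)%MS).
Proof.
pose f : 'End('M[K]_n) := linfun (mulmxr (cokermx x) \o mulmx N).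
have fP B : (B \in lker f) = (N *m B <= x)%MS.
  by rewrite memv_ker lfunE /= -submxE.
have [/subvP sT|/subvPn[B TB fB]] := boolP (T <= lker f)%VS.
  by left=> B /sT; rewrite fP.
by right; exists B; rewrite -?fP.
Qed.

(** When x cannot be sent to a nonzero vector of the row space of N, T has so
    many elements with rows proportional to x that the dimension count succeeds
    with the vectors z of the kernel of N alone. *)
Lemma solvable_of_isolated_row (K : fieldType) (n : nat) (N M : 'M[K]_n.+1)
    (T : {vspace 'M[K]_n.+1}) (x : 'rV[K]_n.+1) :
    pencil_property K n -> N != 0 -> x != 0 -> x *m N = 0 ->
    (\dim T + 2 <= n.+1)%N -> x *m M = 0 ->
    (\rank N <= \dim (T :&: rows_in x))%N ->
  pencil_solvable N M T.
Proof.
move=> IHn N0 x0 xN dimT xM0 rN.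
have [Psi PsiP] := row_constraints T x0.
have tT : (\dim (T :&: rows_in x) <= \dim T)%N by rewrite dimvS ?capvSl.
have /rowV0Pn[c /sub_kermxP cPsi c0] : kermx Psi != 0.
  rewrite -mxrank_eq0 mxrank_ker -lt0n subn_gt0 (leq_ltn_trans (rank_leq_col _)) //.
  by rewrite (leq_ltn_trans tT) // -ltnS -addn2 ltnW // addn2.
have [M1 TM1 xM1] : exists2 M1, annihilates T (M1 - M) & x *m M1 = c.
  by apply: prescribe_row => // B TB Bx; rewrite xM0 subr0 (PsiP c).
have rN0 : (0 < \rank N)%N by rewrite lt0n mxrank_eq0.
have [Tx0|[B]] := nonzero_or_zero (T :&: rows_in x).
  by move: (leq_trans rN0 rN); rewrite Tx0 dimv0.
rewrite memv_cap mem_rows_in => /andP[TB Bx] B0.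
have [|//|] := @count_rank_two K n.+1 (n - \rank N) T x (pencil_solvable N M T) x0;
  last by lia.
move=> L xL rL.
have /row_subPn[i] : ~~ (kermx N <= L)%MS.
  by apply: contraL rL => /mxrankS; rewrite mxrank_ker; lia.
set z := row i _ => zL.
have zN : z *m N = 0 by apply/sub_kermxP; apply: row_sub.
have zx : ~~ (z <= x)%MS by apply: contra zL => /submx_trans; apply.
have [[M2 [TM2 xM2 zM2]]|[phi [psi [TB' phi0 _]]]] :=
    prescribe_second_row T N M1 0 zx; last by right; exists z, phi, psi.
left; have xM20 : x *m M2 != 0 by rewrite xM2 xM1.
have zN2 : (z *m N <= x *m M2)%MS by rewrite zN sub0mx.
rewrite subr0 in zM2.
by apply: (reduce_step IHn dimT (annihilates_trans TM1 TM2) xN xM20 zx zN2 zM2 TB B0);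
  rewrite Bx.
Qed.

(** Here x is sent to [z *m N] for a suitable z of an affine space with direction
    [kermx (N *m Psi)]; z must avoid Av, so that the reduction makes the
    annihilator smaller, and then the dimension count provides some z that is
    sent to the row space of N. *)
Lemma solvable_of_chain (K : fieldType) (n : nat) (N M : 'M[K]_n.+1)
    (T : {vspace 'M[K]_n.+1}) (x y0 z1 : 'rV[K]_n.+1) (Av B : 'M[K]_n.+1)
    (Psi : 'M[K]_(n.+1, \dim (T :&: rows_in x))) :
    pencil_property K n -> x != 0 -> x *m N = 0 ->
    (\dim T + 2 <= n.+1)%N -> x *m M = y0 *m N ->
    (forall c : 'rV_n.+1, c *m Psi = 0 ->
       forall B, B \in T -> (B <= x)%MS -> c *m B = 0) ->
    (Av <= kermx (N *m Psi))%MS -> (kermx N <= Av)%MS ->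
    (z1 - y0 <= kermx (N *m Psi))%MS -> ~~ (z1 <= Av)%MS ->
    B \in T -> B != 0 ->
    (forall z : 'rV_n.+1, ~~ (z <= Av)%MS ->
       (B <= x)%MS || ~~ (z *m N *m B <= x)%MS) ->
  pencil_solvable N M T.
Proof.
move=> IHn x0 xN dimT xM PsiP AvU NAv z1U z1Av TB B0 drop.
set t := \dim (T :&: rows_in x) in Psi PsiP AvU z1U *.
have tT : (t <= \dim T)%N by rewrite dimvS ?capvSl.
have [|//|] := @count_rank_two K n.+1 (n - t) T x (pencil_solvable N M T) x0;
  last by rewrite -/t; lia.
move=> L xL rL.
have UL : ~~ (kermx (N *m Psi) <= L)%MS.
  apply: contraL rL => /mxrankS; rewrite mxrank_ker.
  by have := rank_leq_col (N *m Psi); lia.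
have [z [zU zL zAv]] := affine_avoid AvU z1U z1Av UL.
have zx : ~~ (z <= x)%MS by apply: contra zL => /submx_trans; apply.
have [M1 TM1 xM1] : exists2 M1, annihilates T (M1 - M) & x *m M1 = z *m N.
  apply: prescribe_row => // B' TB' Bx'; rewrite xM -mulmxBl.
  by apply: PsiP => //; rewrite -mulmxA; apply/sub_kermxP.
have [[M2 [TM2 xM2 zM2]]|[phi [psi [TB' phi0 _]]]] :=
    prescribe_second_row T N M1 0 zx; last by right; exists z, phi, psi.
left; have xM20 : x *m M2 != 0.
  rewrite xM2 xM1; apply: contra zAv => /eqP zN0.
  by apply: submx_trans NAv; apply/sub_kermxP.
have zN2 : (z *m N <= x *m M2)%MS by rewrite xM2 xM1.
rewrite subr0 in zM2.
apply: (reduce_step IHn dimT (annihilates_trans TM1 TM2) xN xM20 zx zN2 zM2 TB B0).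
by rewrite xM2 xM1 drop.
Qed.

(** If some B in T has its rows proportional to x, it ensures the decrease of the
    annihilator in every reduction.  Otherwise the image of x is arbitrary, and
    a matrix B for which the rows of [N *m B] are not all multiples of x
    ensures this decrease for all z outside a proper subspace. *)
Lemma solvable_or_constrained (K : fieldType) (n : nat) (N M : 'M[K]_n.+1)
    (T : {vspace 'M[K]_n.+1}) (x : 'rV[K]_n.+1) :
    pencil_property K n -> N != 0 -> x != 0 -> x *m N = 0 -> (x *m M <= N)%MS ->
    (\dim T + 2 <= n.+1)%N ->
  pencil_solvable N M T \/
  (T :&: rows_in x = 0)%VS /\ (forall B, B \in T -> (N *m B <= x)%MS).
Proof.
move=> IHn N0 x0 xN /submxP[y0 xM] dimT.
have [Psi PsiP] := row_constraints T x0.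
pose U := kermx (N *m Psi).
have NU : (kermx N <= U)%MS.
  by apply/sub_kermxP; rewrite mulmxA mulmx_ker mul0mx.
have [Tx0|[B]] := nonzero_or_zero (T :&: rows_in x).
  have [|[B TB NB]] := forall_submx_or T N x; first by right.
  left; have B0 : B != 0 by apply: contra NB => /eqP->; rewrite mulmx0 sub0mx.
  pose Av := kermx (N *m B *m cokermx x).
  have U1 m (A : 'M_(m, n.+1)) : (A <= U)%MS.
    apply/sub_kermxP; suff -> : Psi = 0 by rewrite !mulmx0.
    by apply/eqP; rewrite -mxrank_eq0 -leqn0 (leq_trans (rank_leq_col _)) // Tx0 dimv0.
  have AvP (z : 'rV_n.+1) : (z <= Av)%MS = (z *m N *m B <= x)%MS.
    rewrite [RHS]submxE; apply/idP/idP => [/sub_kermxP|/eqP] zNB; last apply/sub_kermxP.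
      by rewrite -zNB !mulmxA.
    by rewrite -zNB !mulmxA.
  have /row_subPn[i NBi] := NB.
  apply: (@solvable_of_chain _ _ N M T x y0 (delta_mx 0 i) Av B Psi) => //.
  - by apply/sub_kermxP; rewrite 2!mulmxA mulmx_ker !mul0mx.
  - by rewrite AvP -mulmxA -rowE.
  - by move=> z; rewrite AvP => ->; rewrite orbT.
rewrite memv_cap mem_rows_in => /andP[TB Bx] B0; left.
have [/andP[UN xM0]|] := boolP ((U <= kermx N)%MS && (x *m M == 0)).
  apply: (solvable_of_isolated_row IHn N0 x0 xN dimT (eqP xM0)).
  have := mxrankS UN; rewrite /U !mxrank_ker.
  by have := rank_leq_col (N *m Psi); have := rank_leq_row N; 
     have := rank_leq_row (N *m Psi); lia.
move=> NUxM; have [z1 z1U z1N] : exists2 z1 : 'rV_n.+1,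
    (z1 - y0 <= U)%MS & ~~ (z1 <= kermx N)%MS.
  have [xM0|xM0] := eqVneq (x *m M) 0; last first.
    exists y0; rewrite ?subrr ?sub0mx //.
    by apply: contra xM0 => /sub_kermxP <-; rewrite xM.
  move: NUxM; rewrite xM0 eqxx andbT => /row_subPn[i Ui].
  exists (y0 + row i U); first by rewrite addrC addKr row_sub.
  apply: contra Ui => /sub_kermxP; rewrite mulmxDl -xM xM0 add0r => ?.
  exact/sub_kermxP.
by apply: (@solvable_of_chain _ _ N M T x y0 z1 (kermx N) B Psi) => // z _; rewrite Bx.
Qed.

(** * Kernel of N of dimension at least two *)

(** A second kernel vector x' can play the role of x if some matrix of the coset
    sends it to the row space of N.  If that is not so for M itself and cannot
    be arranged by choosing the image of x' freely, then T contains a matrix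
    with rows proportional to x', and there is a reduction along x' with z = x.
    When x and x' both fail to give a reduction, the rows of [N *m B] are
    multiples of both. *)
Lemma solvable_of_corank_gt1 (K : fieldType) (n : nat) (N M : 'M[K]_n.+1)
    (T : {vspace 'M[K]_n.+1}) (x : 'rV[K]_n.+1) :
    pencil_property K n -> N != 0 -> x != 0 -> x *m N = 0 -> (x *m M <= N)%MS ->
    (\dim T + 2 <= n.+1)%N ->
    (forall B, B \in T -> (N *m B <= x)%MS) -> ~~ (kermx N <= x)%MS ->
  pencil_solvable N M T.
Proof.
move=> IHn N0 x0 xN xM dimT NT /row_subPn[i]; set x' := row i _ => x'x.
have x'N : x' *m N = 0 by apply/sub_kermxP; apply: row_sub.
have x'0 : x' != 0 by apply: contraNneq x'x => ->; apply: sub0mx.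
have adm M1 : annihilates T (M1 - M) -> (x' *m M1 <= N)%MS -> pencil_solvable N M T.
  move=> TM1 x'M1.
  have [|[_ NT']] := solvable_or_constrained IHn N0 x'0 x'N x'M1 dimT.
    exact: pencil_solvable_base.
  apply: (solvable_of_mul0 N0 x0 xN xM dimT) => B TB; apply/eqP.
  have /submxP[u defu] := NT' B TB; rewrite defu.
  have [->|u0] := eqVneq u 0; first by rewrite mul0mx.
  by case/negP: x'x; apply: (outer_submx u0); rewrite -defu NT.
have [Tx'0|[B]] := nonzero_or_zero (T :&: rows_in x').
  have [|M1 TM1 x'M1] := @prescribe_row _ _ T M x' 0 x'0.
    move=> B TB Bx'; suff -> : B = 0 by rewrite mulmx0.
    by apply/eqP; rewrite -memv0 -Tx'0 memv_cap TB mem_rows_in.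
  by apply: (adm M1); rewrite // x'M1 sub0mx.
rewrite memv_cap mem_rows_in => /andP[TB Bx'] B0.
have [x'M|x'M] := boolP (x' *m M <= N)%MS.
  by apply: (adm M) => //; rewrite subrr; apply: annihilates0.
have x'M0 : x' *m M != 0 by apply: contraNneq x'M => ->; apply: sub0mx.
have xx' : ~~ (x <= x')%MS.
  apply: contra x'x => /submxP[k defx].
  have k0 : k != 0 by apply: contraNneq x0 => k0; rewrite defx k0 mul0mx.
  by apply: (outer_submx k0); rewrite -defx.
have TM : annihilates T (M - M) by rewrite subrr; apply: annihilates0.
have xN' : (x *m N <= x' *m M)%MS by rewrite xN sub0mx.
by apply: (reduce_step IHn dimT TM x'N x'M0 xx' xN' xM TB B0); rewrite Bx'.
Qed.

(** * Kernel of N of dimension one *)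

(** The first quotient turns the condition on [N *m B] into the vanishing of the
    products with the annihilator, so that multiples of the induced N can be
    added freely there, and [pencil_completion] finishes. *)
Lemma solvable_of_two_steps (K : fieldType) (n : nat) (N M M1 : 'M[K]_n.+1)
    (T : {vspace 'M[K]_n.+1}) (x y : 'rV[K]_n.+1) :
    annihilates T (M1 - M) -> x *m N = 0 -> x *m M1 = y *m N ->
    y *m N != 0 -> (y *m M1 <= N)%MS -> ~~ (y <= x)%MS ->
    (forall theta : 'cV_n.+1, N *m theta = 0 -> M1 *m theta = 0 -> theta = 0) ->
    (forall B, B \in T -> (N *m B <= x)%MS) ->
  pencil_solvable N M T.
Proof.
move=> TM1 xN xM yN yM yx inj NT.
have x0 : x != 0.
  by apply: contraNneq yN => x0; rewrite -xM x0 mul0mx.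
have [U Uu Ux] := @complete_basis K n x x0.
have [W Wu Wc] := @complete_basis K n _ yN.
rewrite -Ux in xN NT; rewrite -Ux -Wc in xM; rewrite -Ux in yx.
have [|z [z0 zN zM]] := compress_kernel Uu Wu xN xM yx; first by rewrite Wc.
have {}zM := zM (submx_trans yM (addsmxSl _ _)).
have inj' := compress_common_kernel Uu Wu xN xM inj.
have [E Eu] := pencil_completion z0 zN zM inj'.
have [|A [TA xA cA]] := @compress_lift _ _ U W M1 T
    (compress U W M1 + E *m compress U W N) Uu Wu xM.
  move=> B TB; rewrite addrC addKr mxtrace_mulC -mulmxA.
  by rewrite (compress_ann_mul0 Uu Wu xN NT TB) mulmx0 mxtrace0.
exists A => [|lambda]; first exact: annihilates_trans TA.
rewrite (compress_unit Uu Wu); last by rewrite mulmxDr -scalemxAr xN scaler0 addr0.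
by rewrite linearD linearZ /= cA.
Qed.

(** When the kernel of N is a line, so is its column kernel, and a generator phi
    of the latter is an equation of the row space. *)
Lemma corank_one_cokernel (K : fieldType) (n : nat) (N : 'M[K]_n)
    (x : 'rV[K]_n) :
    x != 0 -> x *m N = 0 -> (kermx N <= x)%MS ->
  exists phi : 'cV_n, [/\ phi != 0, N *m phi = 0,
    forall p (A : 'M_(n, p)), N *m A = 0 -> exists k, A = phi *m k
    & forall c : 'rV_n, c *m phi = 0 -> (c <= N)%MS].
Proof.
move=> x0 xN Nx.
have rk : \rank (kermx N^T) = 1%N.
  have : \rank (kermx N) = \rank x.
    by apply/eqP; rewrite eqn_leq !mxrankS //; apply/sub_kermxP.
  by rewrite !mxrank_ker mxrank_tr rank_rV x0.
have /rowV0Pn[v vN v0] : kermx N^T != 0 by rewrite -mxrank_eq0 rk.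
have Nv : (kermx N^T <= v)%MS.
  by rewrite -(geq_leqif (mxrank_leqif_sup vN)) rk rank_rV v0.
have phiP p (A : 'M_(n, p)) : N *m A = 0 -> exists k, A = v^T *m k.
  move=> NA; have /submxP[k Ak] : (A^T <= v)%MS.
    by apply: submx_trans Nv; apply/sub_kermxP; rewrite -trmx_mul NA trmx0.
  by exists k^T; rewrite -trmx_mul -Ak trmxK.
exists v^T; split=> //; first by rewrite trmx_eq0.
  by apply: trmx_inj; rewrite trmx_mul trmxK trmx0; apply/sub_kermxP.
move=> c cv; have [k ck] := phiP _ _ (mulmx_coker N).
by rewrite submxE ck mulmxA cv mul0mx.
Qed.

(** The companion matrix of [X^2 + X + 1] has no eigenvalue in the field with two
    elements. *)
Lemma unit_pencil_without_01 (K : fieldType) :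
  (forall lambda : K, lambda = 0 \/ lambda = 1) ->
  exists A : 'M[K]_2, forall lambda : K, A + lambda%:M \in unitmx.
Proof.
move=> K2; pose A : 'M[K]_(1 + 1) := block_mx 0 1%:M 1%:M 1%:M.
exists A => lambda; rewrite -scalemx1; case: (K2 lambda) => ->.
  rewrite scale0r addr0.
  suff /mulmx1_unit[] : A *m block_mx (- 1%:M) 1%:M 1%:M 0 = 1%:M by [].
  rewrite mulmx_block !(mul1mx, mul0mx, add0r, addr0) addNr.
  by rewrite -scalar_mx_block.
rewrite scale1r; have -> : A + 1%:M = block_mx 1%:M 1%:M 1%:M (1%:M + 1%:M).
  by rewrite [in LHS](@scalar_mx_block _ 1 1) add_block_mx add0r !addr0.
suff /mulmx1_unit[] : block_mx 1%:M 1%:M 1%:M (1%:M + 1%:M) *m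
    block_mx (1%:M + 1%:M) (- 1%:M) (- 1%:M) 1%:M = 1%:M :> 'M[K]_(1 + 1) by [].
rewrite mulmx_block !(mul1mx, mulmx1, mulmxN) addrK subrr addKr addNr.
by rewrite -scalar_mx_block.
Qed.

(** The second factors z of the elements of T of the form
    [phi *m z + psi *m x] are determined by these elements modulo x; the bound
    makes Z a proper subspace when [\dim T + 2 <= n]. *)
Lemma proper_exclusion (K : fieldType) (n : nat) (T : {vspace 'M[K]_n})
    (x : 'rV[K]_n) (phi : 'cV[K]_n) :
    phi != 0 ->
  exists Z : {vspace 'rV[K]_n}, [/\ (\dim Z <= (\dim T).+1)%N, x \in Z &
    forall (z : 'rV_n) (psi : 'cV_n), phi *m z + psi *m x \in T -> z \in Z].
Proof.
rewrite -trmx_eq0 => /dual_vector_exists1[theta' phi_theta].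
pose theta := theta'^T.
have theta_phi : theta *m phi = 1%:M.
  by rewrite -[phi]trmxK -trmx_mul phi_theta trmx1.
pose f : 'Hom('M[K]_n, 'rV[K]_n) := linfun (mulmx theta).
exists (f @: T + <[x]>)%VS; split.
- rewrite (leq_trans (dimv_add_leqif _ _)) // -[(\dim T).+1]addn1 leq_add //.
    by rewrite -[leqRHS](limg_ker_dim f T) leq_addl.
  by rewrite dim_vline; case: eqP.
- by rewrite (subvP (addvSr _ _)) // memv_line.
move=> z psi TB; have -> : z = theta *m (phi *m z + psi *m x) - theta *m psi *m x.
  by rewrite mulmxDr !mulmxA theta_phi mul1mx addrK.
rewrite memv_add //; last first.
  by rewrite memvN [theta *m psi]mx11_scalar mul_scalar_mx memvZ // memv_line.
by rewrite -[theta *m _]/(mulmx theta _) -lfunE memv_img.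
Qed.

(** With u outside the row space of N and x sent to u, the annihilator vanishes in
    the quotients, and N induces an invertible matrix of order 2 there: the
    pencil is then invertible when the constant term is this matrix times one
    without eigenvalue. *)
Lemma solvable_order_three (K : fieldType) (N M : 'M[K]_3)
    (T : {vspace 'M[K]_3}) (x : 'rV[K]_3) (phi : 'cV[K]_3) (B : 'M[K]_3) :
    (forall lambda : K, lambda = 0 \/ lambda = 1) ->
    x != 0 -> x *m N = 0 -> (kermx N <= x)%MS -> phi != 0 -> N *m phi = 0 ->
    (\dim T <= 1)%N -> (T :&: rows_in x = 0)%VS ->
    B \in T -> B != 0 -> (exists (z : 'rV_3) psi, B = phi *m z + psi *m x) ->
  pencil_solvable N M T.
Proof.
move=> K2 x0 xN Nx phi0 Nphi dimT Tx0 TB B0 [z [psi defB]].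
have [u u_phi] : exists u : 'rV_3, u *m phi = 1%:M.
  move: phi0; rewrite -trmx_eq0 => /dual_vector_exists1[v phi_v].
  by exists v^T; rewrite -[phi]trmxK -trmx_mul phi_v trmx1.
have u0 : u != 0.
  apply: contra_eqN u_phi => /eqP->; rewrite mul0mx eq_sym.
  by apply/eqP=> /matrixP/(_ 0 0)/eqP; rewrite !mxE oner_eq0.
have Tx C : C \in T -> (C <= x)%MS -> C = 0.
  by move=> TC xC; apply/eqP; rewrite -memv0 -Tx0 memv_cap TC mem_rows_in.
have [M1 TM1 xM1] : exists2 M1, annihilates T (M1 - M) & x *m M1 = u.
  by apply: prescribe_row => // C TC /(Tx _ TC)->; rewrite mulmx0.
have uB : ~~ (u *m B <= x)%MS.
  apply: contra B0 => uBx; apply/eqP/Tx => //.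
  have zx : (z <= x)%MS.
    have -> : z = u *m B - u *m psi *m x.
      by rewrite defB mulmxDr !mulmxA u_phi mul1mx addrK.
    by rewrite addmx_sub // eqmx_opp submxMl.
  by rewrite defB addmx_sub ?submxMl // mulmx_sub.
have [U Uu Ux] := @complete_basis K 2 x x0.
have [W Wu Wc] := @complete_basis K 2 u u0.
have ltT : (\dim (compress_ann U W T) < \dim T)%N.
  by apply: (dim_compress_ann_lt Uu TB B0); rewrite Ux Wc uB orbT.
have T'0 : compress_ann U W T = 0%VS.
  by apply/eqP; rewrite -dimv_eq0 -leqn0 -ltnS; apply: leq_trans ltT dimT.
rewrite -Ux -Wc in xM1; rewrite -Ux in xN.
have N'u : compress U W N \in unitmx.
  apply: compress_nonsingular => // z1; rewrite Wc Ux => /submxP[k z1N].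
  apply: submx_trans Nx; apply/sub_kermxP; rewrite z1N.
  have := congr1 (mulmxr phi) z1N; rewrite /= -!mulmxA Nphi u_phi mulmx0 mulmx1.
  by move=> <-; rewrite mul0mx.
have [A Au] := unit_pencil_without_01 K2.
have [|A1 [TA xA cA]] := @compress_lift _ _ U W M1 T (A *m compress U W N) Uu Wu xM1.
  by move=> C; rewrite T'0 memv0 => /eqP->; rewrite mul0mx mxtrace0.
exists A1 => [|lambda]; first exact: annihilates_trans TA.
rewrite (compress_unit Uu Wu); last by rewrite mulmxDr -scalemxAr xN scaler0 addr0.
rewrite linearD linearZ /= cA -mul_scalar_mx -mulmxDl unitmx_mul Au.
exact: N'u.
Qed.

(** Sending x to [y *m N] and y to the row space of N is possible for all y
    outside the proper subspace Z, and [solvable_of_two_steps] concludes unless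
    phi is then annihilated.  That happens for all such y only if the trace
    against M of any B in T is the value at y of the linear function given by
    [N *m B *m xi].  If this function vanishes then [B = phi *m z] for some z,
    and sending x to [z *m N] is successful.  If it does not vanish, being
    constant on the complement of Z, it has kernel Z and K has two elements;
    this forces the order of the matrices to be 3. *)
Lemma solvable_of_corank1 (K : fieldType) (n : nat) (N M : 'M[K]_n.+1)
    (T : {vspace 'M[K]_n.+1}) (x : 'rV[K]_n.+1) :
    N != 0 -> x != 0 -> x *m N = 0 -> (x *m M <= N)%MS ->
    (\dim T + 2 <= n.+1)%N -> (T :&: rows_in x = 0)%VS ->
    (forall B, B \in T -> (N *m B <= x)%MS) -> (kermx N <= x)%MS ->
  pencil_solvable N M T.
Proof.
move=> N0 x0 xN xM dimT Tx0 NT Nx.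
have [phi [phi0 Nphi phiP coker]] := corank_one_cokernel x0 xN Nx.
have [Z [dimZ Zx ZP]] := proper_exclusion T x phi0.
have [xi x_xi] := dual_vector_exists1 x0.
have [u u_phi] : exists u : 'rV_n.+1, u *m phi = 1%:M.
  move: phi0; rewrite -trmx_eq0 => /dual_vector_exists1[v phi_v].
  by exists v^T; rewrite -[phi]trmxK -trmx_mul phi_v trmx1.
have n1 (R : nzRingType) : (1%:M : 'M[R]_1) != 0.
  by apply/eqP=> /matrixP/(_ 0 0)/eqP; rewrite !mxE oner_eq0.
have Tx C : C \in T -> (C <= x)%MS -> C = 0.
  by move=> TC xC; apply/eqP; rewrite -memv0 -Tx0 memv_cap TC mem_rows_in.
have first_row c : exists2 M1, annihilates T (M1 - M) & x *m M1 = c.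
  by apply: prescribe_row => // C TC /(Tx _ TC)->; rewrite mulmx0.
have notx y : y \notin Z -> ~~ (y <= x)%MS.
  by apply: contra => /sub_rVP[k ->]; rewrite memvZ.
have second_row y M1 v : y \notin Z -> annihilates T (M1 - M) ->
    exists M2, [/\ annihilates T (M2 - M), x *m M2 = x *m M1
                 & (y *m M2 - v <= N)%MS].
  move=> yZ TM1; have [[M2 [TM2 xM2 yM2]]|] := prescribe_second_row T N M1 v (notx y yZ).
    by exists M2; split=> //; apply: annihilates_trans TM2.
  move=> [phi' [psi [TB phi'0 /phiP[k defphi']]]]; case/negP: yZ.
  have k0 : k 0 0 != 0.
    apply: contraNneq phi'0 => k0.
    by rewrite defphi' [k]mx11_scalar k0 -scalemx1 scale0r mulmx0.
  have ky : k 0 0 *: y \in Z.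
    apply: (ZP _ psi); rewrite -mul_scalar_mx -mx11_scalar mulmxA -defphi'.
    exact: TB.
  by rewrite -[y](scalerK k0) memvZ.
have [y0 y0Z] : exists y0, y0 \notin Z.
  have /subvPn[y0 _ y0Z] : ~~ (fullv <= Z)%VS; last by exists y0.
  by apply/negP=> /dimvS; rewrite dimvf /dim /= mul1n; lia.
have [//|unsolv] := classic (pencil_solvable N M T).
have two_steps M1 y : annihilates T (M1 - M) -> x *m M1 = y *m N ->
    (y *m M1 <= N)%MS -> ~~ (y <= x)%MS -> M1 *m phi = 0.
  move=> TM1 xM1 yM1 yx; apply/eqP/negPn/negP=> M1phi; apply: unsolv.
  apply: (solvable_of_two_steps TM1 xN xM1 _ yM1 yx _ NT).
    by apply: contra yx => /eqP yN; apply: submx_trans Nx; apply/sub_kermxP.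
  move=> theta /phiP[k ->]; rewrite mulmxA => Mk.
  suff -> : k = 0 by rewrite mulmx0.
  by apply: (@submx0null _ 1 1 1); apply: (outer_submx M1phi); rewrite Mk sub0mx.
(* If B were not zero, it would be some phi *m z, and every matrix of the
   coset would send z to the row space of N. *)
have flat_trace_inj B : B \in T -> N *m B = 0 -> \tr (B *m M) = 0 -> B = 0.
  move=> TB NB trB; have [z defB] := phiP _ _ NB.
  have [zx|zx] := boolP (z <= x)%MS; first by rewrite (Tx B) // defB mulmx_sub.
  have [M1 TM1 xM1] := first_row (z *m N).
  have [M2 [TM2 xM2 yM2]] := second_row y0 M1 u y0Z TM1.
  have M2phi : M2 *m phi = 0.
    apply: (two_steps M2 z) => //; first by rewrite xM2.
    apply: coker; apply/matrixP=> i j; rewrite !ord1 [RHS]mxE -trace_inner -defB.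
    by rewrite (annihilates_trace TM2 TB).
  have /submxP[k yk] := yM2; have := congr1 (mulmxr phi) yk.
  rewrite /= -mulmxA Nphi mulmx0 mulmxBl -mulmxA M2phi mulmx0 u_phi sub0r.
  by move=> /eqP; rewrite oppr_eq0 (negPf (n1 K)).
(* B is the sum of some phi *m z, which does not contribute to the trace
   because M2 annihilates phi, and of B *m xi *m x. *)
have trace_formula y B : y \notin Z -> B \in T ->
    \tr (B *m M) = (y *m (N *m B *m xi)) 0 0.
  move=> yZ TB; have [M1 TM1 xM1] := first_row (y *m N).
  have [M2 [TM2 xM2 yM2]] := second_row y M1 0 yZ TM1; rewrite subr0 in yM2.
  have M2phi : M2 *m phi = 0.
    by apply: (two_steps M2 y) => //; [rewrite xM2 | apply: notx].
  have /submxP[v NB] := NT B TB.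
  have [z defB] : exists z, B - B *m xi *m x = phi *m z.
    apply: phiP; rewrite mulmxBr !mulmxA NB -(mulmxA v) x_xi mulmx1.
    by rewrite subrr.
  have BE : B = phi *m z + B *m xi *m x by rewrite -defB subrK.
  rewrite -(annihilates_trace TM2 TB) {1}BE mulmxDl mxtraceD !trace_inner.
  by rewrite -mulmxA M2phi mulmx0 mxE add0r xM2 xM1 !mulmxA.
have off_Z (g : 'cV_n.+1) : (forall y, y \notin Z -> (y *m g) 0 0 = 0) -> g = 0.
  move=> g0; have {}g0 (y : 'rV_n.+1) : (y *m g) 0 0 = 0.
    have [yZ|/g0//] := boolP (y \in Z).
    have : y + y0 \notin Z.
      by apply: contra y0Z => yy0; rewrite -(addKr y y0) memvD ?memvN.
    by move=> /g0; rewrite mulmxDl mxE (g0 y0) // addr0.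
  by apply/colP=> i; rewrite [RHS]mxE -(g0 (delta_mx 0 i)) -rowE mxE.
have NBx B : B \in T -> N *m B = N *m B *m xi *m x.
  by move=> /NT/submxP[v ->]; rewrite -(mulmxA v) x_xi mulmx1.
have tr_inj B : B \in T -> \tr (B *m M) = 0 -> B = 0.
  move=> TB trB; apply: flat_trace_inj => //.
  rewrite NBx // (off_Z (N *m B *m xi)) ?mul0mx // => y yZ.
  by rewrite -(trace_formula y B yZ TB).
have [NT0|[B1 TB1 NB1]] := forall_submx_or T N (0 : 'rV_n.+1).
  by apply: (solvable_of_mul0 N0 x0 xN xM dimT) => B /NT0/submx0null.
have B10 : B1 != 0 by apply: contraNneq NB1 => ->; rewrite mulmx0 sub0mx.
have b0 : \tr (B1 *m M) != 0 by apply: contra B10 => /eqP/(tr_inj _ TB1)->.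
(* The complement of Z is stable under nonzero scalars, and a nonzero linear
   function is constant there. *)
have K2 lambda : lambda = 0 \/ lambda = 1 :> K.
  have [->|l0] := eqVneq lambda 0; [by left | right].
  have lZ : lambda *: y0 \notin Z.
    by apply: contra y0Z => ly0; rewrite -[y0](scalerK l0) memvZ.
  apply: (mulIf b0); rewrite mul1r {1}(trace_formula _ _ y0Z TB1).
  by rewrite (trace_formula _ _ lZ TB1) -scalemxAl [RHS]mxE.
(* The trace against M is injective on T and takes only the values 0 and 1. *)
have T1 : (T <= <[B1]>)%VS.
  apply/subvP=> B TB; have [/(tr_inj _ TB)->|trB] := K2 (\tr (B *m M)).
    by rewrite mem0v.
  have [b|b] := K2 (\tr (B1 *m M)); first by rewrite b eqxx in b0.
  suff /eqP : B - B1 = 0 by rewrite subr_eq0 => /eqP->; apply: memv_line.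
  apply: tr_inj; first by rewrite memvB.
  by rewrite mulmxBl linearB /= trB b subrr.
have dimT1 : (\dim T <= 1)%N.
  by apply: leq_trans (dimvS T1) _; rewrite dim_vline; case: eqP.
have dimT0 : (0 < \dim T)%N.
  by rewrite lt0n dimv_eq0; apply: contraNneq B10 => T0; rewrite -memv0 -T0.
have leZ : (n <= \dim Z)%N.
  pose g : 'Hom('rV[K]_n.+1, 'M[K]_1) := linfun (mulmxr (N *m B1 *m xi)).
  have gZ : (lker g <= Z)%VS.
    apply/subvP=> y; rewrite memv_ker lfunE /= => /eqP yf.
    have [//|yZ] := boolP (y \in Z).
    by case/eqP: b0; rewrite (trace_formula _ _ yZ TB1) yf mxE.
  have := limg_ker_dim g fullv; rewrite capfv dimvf /dim /= mul1n => dimg.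
  have limg1 : (\dim (limg g) <= 1)%N.
    by rewrite (leq_trans (dimvS (subvf _))) ?dimvf.
  apply: leq_trans (dimvS gZ).
  by rewrite -(leq_add2r (\dim (limg g))) dimg -[leqRHS]addn1 leq_add2l.
have n2 : n = 2%N.
  apply/anti_leq; rewrite (leq_trans leZ) ?(leq_trans dimZ) //=.
  by move: dimT; rewrite addn2 ltnS; apply: leq_trans.
subst n; apply: (solvable_order_three M K2 x0 xN Nx phi0 Nphi dimT1 Tx0 TB1 B10).
have [z defB] : exists z, B1 - B1 *m xi *m x = phi *m z.
  by apply: phiP; rewrite mulmxBr !mulmxA -NBx // subrr.
by exists z, (B1 *m xi); rewrite -defB subrK.
Qed.

Lemma pencil_propertyP (K : fieldType) (n : nat) : pencil_property K n.
Proof.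
elim: n => [|n IHn] N M T x x0 xN xM dimT.
  by rewrite addn2 in dimT.
have [N0|N0] := eqVneq N 0.
  have [|A TA Au] := @coset_has_unit K n.+1 T M.
    by apply: leq_trans dimT; rewrite addn2.
  by exists A => // lambda; rewrite N0 scaler0 addr0.
have [//|[Tx0 NT]] := solvable_or_constrained IHn N0 x0 xN xM dimT.
have [Nx|Nx] := boolP (kermx N <= x)%MS.
  exact: solvable_of_corank1 Nx.
exact: solvable_of_corank_gt1 Nx.
Qed.

(** * The theorem for column vectors *)

(** The difference of two vectors with the same class is a kernel vector; passing
    to transposes turns it into a row vector. *)
Lemma kernel_vector_of_noninjective (K : fieldType) (n : nat) (N M : 'M[K]_n) :
    ~ injective (@ker_to_coker K n N M) ->
  exists x : 'rV[K]_n, [/\ x != 0, x *m N^T = 0 & (x *m M^T <= N^T)%MS].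
Proof.
move=> notinj; have [X [X' [eqX neqX]]] : exists X X',
    @ker_to_coker K n N M X = @ker_to_coker K n N M X' /\ X <> X'.
  apply: NNPP => noX; apply: notinj => X X' eqX; apply: NNPP => neqX.
  by apply: noX; exists X, X'.
exists (vsval X - vsval X')^T; split.
- rewrite trmx_eq0 subr_eq0; apply: contra_not_neq neqX => eqXX'.
  exact: val_inj.
- have : vsval X - vsval X' \in Ker N by rewrite memvB ?subvsP.
  by rewrite memv_ker lfunE /= => /eqP NX; rewrite -trmx_mul NX trmx0.
move: eqX; rewrite /ker_to_coker => /eqP; rewrite eqquotE Quotient.equivE.
rewrite -mulmxBr => /memv_imgP[Y _]; rewrite lfunE /= -trmx_mul => ->.
by rewrite trmx_mul submxMl.
Qed.

Theorem theorem6 (K : fieldType) (n : nat) (N : 'M[K]_n)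
    (S0 : 'M[K]_n) (V : {vspace 'M[K]_n}) :
  N \notin unitmx ->
  codim V <= n%:Z - 2 ->
  (exists2 M : 'M[K]_n, M \in affine S0 V & ~ injective (@ker_to_coker K n N M)) ->
  exists2 A : 'M[K]_n, A \in affine S0 V &
    forall lambda : K, A + lambda *: N \in unitmx.
Proof.
move=> _ codimV [M SM /kernel_vector_of_noninjective[x [x0 xN xM]]].
pose tr : 'End('M[K]_n) := linfun trmx.
have [T dimT annT] := annihilator_exists (tr @: V)%VS.
have dimV : \dim (tr @: V) = \dim V.
  apply: limg_dim_eq; apply/eqP; rewrite -subv0; apply/subvP=> B.
  rewrite memv_cap memv_ker lfunE /= => /andP[_].
  by rewrite trmx_eq0 memv0.
have {}dimT : (\dim T + 2 <= n)%N.
  have leV : (\dim V <= n * n)%N by rewrite (leq_trans (dimvS (subvf V))) ?dimvf.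
  move: dimT codimV leV; rewrite dimV /codim -mulnn.
  move: (\dim T) (\dim V) (n * n)%N => t v nn; lia.
have [A TA Au] := pencil_propertyP x0 xN xM dimT.
exists A^T => [|lambda]; last by rewrite -unitmx_tr linearD linearZ /= trmxK Au.
have : A - M^T \in (tr @: V)%VS by apply: annT.
case/memv_imgP => B VB; rewrite lfunE /= => defB.
have AM : A^T - M \in V by rewrite -[M]trmxK -linearB /= defB trmxK.
by have := memvD AM SM; rewrite addrA subrK.
Qed.
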